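(* Let $(\hat W,\hat R)$, with $\hat W=\{\hat W_j^n\}_{0\le j\le M,\,0\le n\le N}$ and $\hat R=\{\hat R^n\}_{0\le n\le N}$, be the solution of the finite difference scheme (S3) described in the context. If $\Delta t<1/L$, then $$\hat W_j^n>0,\qquad 1\le n\le N,\quad 0\le j\le M-1,$$ and $$\hat R^n>\hat R^{n-1},\qquad 1\le n\le N.$$
   Context: Data: $d,\mu,h_0,T,L$ are positive constants; $f:\mathbb{R}\to\mathbb{R}$ is differentiable and satisfies $-Lu\le f(u)\le Lu$ and $|f'(u)|\le L$ for all $u\ge 0$. The initial function satisfies $u_0\in C^2([0,h_0])$, $u_0'(0)=0$, $u_0(h_0)=0$, and $u_0(r)>0$ for $0\le r<h_0$. Mesh: $M\ge2$ and $N\ge1$ are integers, $\Delta\hat z=1/M$, $\Delta t=T/N$, $\hat z_j=j\Delta\hat z$ for $0\le j\le M$. Difference operators: $\delta_t U_j^n=\frac{U_j^n-U_j^{n-1}}{\Delta t}$, $\delta_t Q^n=\frac{Q^n-Q^{n-1}}{\Delta t}$, $\delta_{\hat z} U_{j+\frac12}^n=\frac{U_{j+1}^n-U_j^n}{\Delta\hat z}$ for $0\le j\le M-1$, and $\delta_{\hat z}^2U_j^n=\frac1{\Delta\hat z}\bigl(\delta_{\hat z}U_{j+\frac12}^n-\delta_{\hat z}U_{j-\frac12}^n\bigr)$ for $1\le j\le M-1$. Scheme (S3) (a discretization of the radially symmetric problem $u_t-d(u_{rr}+\frac1ru_r)=f(u)$ on $0<r<h(t)$, $u_r(t,0)=0$,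 $u(t,h(t))=0$, $h'(t)=-\mu u_r(t,h(t))$, $h(0)=h_0$, $u(0,r)=u_0(r)$, after the change of variables $\hat z=r/h(t)$, $\hat w(t,\hat z)=u(t,r)$, $\hat r(t)=h^2(t)$; $\hat W_j^n,\hat R^n$ approximate $\hat w(t_n,\hat z_j),\hat r(t_n)$ with $t_n=n\Delta t$): the initial values are $\hat R^0=h_0^2$, $\hat W_j^0=u_0(\hat z_jh_0)$, $0\le j\le M$, and for $1\le n\le N$ $$\hat R^n\hat z_j\,\delta_t\hat W_j^n-d\,\hat z_j\,\delta_{\hat z}^2\hat W_j^n-\Bigl(d+\frac{\hat z_j^2\,\delta_t\hat R^n}{2}\Bigr)\delta_{\hat z}\hat W_{j+\frac12}^n=\hat R^n\hat z_j\,f(\hat W_j^{n-1}),\quad 1\le j\le M-1,$$ $$\delta_{\hat z}\hat W_{\frac12}^n=0,\qquad \hat W_M^n=0,\qquad \delta_t\hat R^n=-2\mu\,\delta_{\hat z}\hat W_{M-\frac12}^{n-1}.$$ *)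

(* Defs.v *)
From Stdlib Require Import Reals.
Open Scope R_scope.

Definition icc (a b x : R) : Prop := a <= x <= b.

(* C^2([a,b]).  The derivatives and the continuity of the second derivative
   are relative to [a,b], hence one-sided at the end points; the values of u
   outside [a,b] play no role. *)
Definition C2_on (a b : R) (u : R -> R) : Prop :=
  exists u1 u2 : R -> R, forall x : R, icc a b x ->
    D_in u u1 (icc a b) x /\ D_in u1 u2 (icc a b) x /\
    continue_in u2 (icc a b) x.

(* Grid functions are total functions on nat; the scheme below only constrains
   the values at the mesh indices. *)

Definition delta_t (dt : R) (Q : nat -> R) (n : nat) : R :=
  (Q n - Q (n - 1)%nat) / dt.

(* [delta_z dz U j] is the difference quotient at the half-index j + 1/2. *)
Definition delta_z (dz : R) (U : nat -> R) (j : nat) : R :=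
  (U (j + 1)%nat - U j) / dz.

Definition delta_z2 (dz : R) (U : nat -> R) (j : nat) : R :=
  (delta_z dz U j - delta_z dz U (j - 1)%nat) / dz.

Definition mesh_dz (M : nat) : R := 1 / INR M.
Definition mesh_dt (T : R) (N : nat) : R := T / INR N.
Definition mesh_z (M j : nat) : R := INR j * mesh_dz M.

(* [What n j] and [Rhat n] are the unknowns at time level n; the half-indices
   1/2 and M - 1/2 are 0 + 1/2 and (M - 1) + 1/2. *)
Record scheme_S3 (d mu h0 T : R) (f u0 : R -> R) (M N : nat)
    (What : nat -> nat -> R) (Rhat : nat -> R) : Prop := {
  S3_init_R : Rhat 0%nat = h0 ^ 2;
  S3_init_W : forall j : nat, (0 <= j <= M)%nat ->
    What 0%nat j = u0 (mesh_z M j * h0);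
  S3_interior : forall n j : nat, (1 <= n <= N)%nat -> (1 <= j <= M - 1)%nat ->
    Rhat n * mesh_z M j * delta_t (mesh_dt T N) (fun k => What k j) n
    - d * mesh_z M j * delta_z2 (mesh_dz M) (What n) j
    - (d + mesh_z M j ^ 2 * delta_t (mesh_dt T N) Rhat n / 2)
      * delta_z (mesh_dz M) (What n) j
    = Rhat n * mesh_z M j * f (What (n - 1)%nat j);
  S3_left : forall n : nat, (1 <= n <= N)%nat ->
    delta_z (mesh_dz M) (What n) 0%nat = 0;
  S3_right : forall n : nat, (1 <= n <= N)%nat -> What n M = 0;
  S3_front : forall n : nat, (1 <= n <= N)%nat ->
    delta_t (mesh_dt T N) Rhat n
    = - 2 * mu * delta_z (mesh_dz M) (What (n - 1)%nat) (M - 1)%nat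
}.

(* Main.v *)
Require Import Defs.
From Stdlib Require Import Reals Lra Lia.
From Coquelicot Require Import Coquelicot.
Open Scope R_scope.

(** Both conclusions are proved together by induction on the time level, the
    invariant being that the front value is positive and that the profile is
    positive at the nodes [0 .. M-1] and zero at the node [M].

    Given the invariant at level [n-1], the front equation is explicit: the
    last difference quotient of the old profile is negative, so the front
    advances.  Hence its new value and its increment are positive, and they
    are coefficients of the equation for the new profile.

    That equation is implicit for diffusion and drift but explicit for the
    reaction.  Moving the old values to the right gives at each interior node
    an inequality
      [a_j W_j - b_j (W_(j+1) - W_j) + c_j (W_j - W_(j-1)) > 0]
    with positive coefficients.  The right-hand side is a positive multiple of
    [w_j / dt + f(w_j)], which is at least [w_j (1/dt - L)], and this is where
    [dt < 1/L] enters ([explicit_reaction_pos]).  A nonpositive minimum of the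
    new profile would contradict this inequality ([discrete_min_principle]);
    the drift does not interfere because it is discretized by the forward
    difference and, as the front advances, has a positive coefficient. *)

Lemma argmin_upto (V : nat -> R) (m : nat) :
  exists k : nat, (k <= m)%nat /\ forall i : nat, (i <= m)%nat -> V k <= V i.
Proof.
induction m as [|m [k [Hk Hmin]]].
- exists 0%nat; split; [lia|].
  intros i Hi; replace i with 0%nat by lia; lra.
- destruct (Rle_lt_dec (V k) (V (S m))) as [Hle|Hlt].
  + exists k; split; [lia|]; intros i Hi.
    destruct (Nat.eq_dec i (S m)) as [->|Hne]; [exact Hle|apply Hmin; lia].
  + exists (S m); split; [lia|]; intros i Hi.
    destruct (Nat.eq_dec i (S m)) as [->|Hne]; [lra|].
    assert (V k <= V i) by (apply Hmin; lia); lra.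
Qed.

(** At a nonpositive minimum over [0 .. M-1] neither neighbour is smaller,
    the node [M] included since [V M = 0] there; so all three terms of the
    inequality would be nonpositive. *)
Lemma discrete_min_principle (M : nat) (a b c V : nat -> R) :
  (2 <= M)%nat ->
  V 0%nat = V 1%nat -> V M = 0 ->
  (forall j : nat, (1 <= j <= M - 1)%nat ->
     0 <= a j /\ 0 <= b j /\ 0 <= c j /\
     0 < a j * V j - b j * (V (j + 1)%nat - V j)
         + c j * (V j - V (j - 1)%nat)) ->
  forall j : nat, (j <= M - 1)%nat -> 0 < V j.
Proof.
intros HM Hleft Hright Hop j Hj.
destruct (argmin_upto V (M - 1)) as [k0 [Hk0 Hmin0]].
(* The Neumann condition lets a minimum at node 0 be moved to node 1, where
   the inequality holds. *)
assert (Hk : exists k : nat, (1 <= k <= M - 1)%nat /\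
          forall i : nat, (i <= M - 1)%nat -> V k <= V i).
{ destruct (Nat.eq_dec k0 0) as [->|Hne].
  - exists 1%nat; split; [lia|].
    intros i Hi; rewrite <- Hleft; apply Hmin0; exact Hi.
  - exists k0; split; [lia|exact Hmin0]. }
destruct Hk as [k [Hk Hmin]].
apply Rlt_le_trans with (V k); [|apply Hmin; exact Hj].
destruct (Rlt_le_dec 0 (V k)) as [Hpos|Hneg]; [exact Hpos|exfalso].
destruct (Hop k Hk) as [Ha [Hb [Hc Hineq]]].
assert (Hnext : V k <= V (k + 1)%nat).
{ destruct (Nat.eq_dec (k + 1) M) as [->|Hne]; [lra|apply Hmin; lia]. }
assert (Hprev : V k <= V (k - 1)%nat) by (apply Hmin; lia).
nra.
Qed.

(** Source of the time step restriction: the reaction is treated explicitly,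
    so within one step it must not consume all that is present. *)
Lemma explicit_reaction_pos (L dt w fw : R) :
  0 < L -> 0 < dt -> dt < 1 / L -> 0 < w -> - L * w <= fw ->
  0 < w / dt + fw.
Proof.
intros HL Hdt Hstep Hw Hfw.
assert (HLdt : L * dt < 1).
{ apply Rmult_lt_compat_l with (r := L) in Hstep; [|exact HL].
  replace (L * (1 / L)) with 1 in Hstep by (field; lra); exact Hstep. }
assert (Hpos : 0 < w * (1 - L * dt) / dt).
{ apply Rdiv_lt_0_compat; [apply Rmult_lt_0_compat; lra|exact Hdt]. }
replace (w * (1 - L * dt) / dt) with (w / dt - L * w) in Hpos
  by (field; lra).
lra.
Qed.

Lemma mesh_dz_pos (M : nat) : (1 <= M)%nat -> 0 < mesh_dz M.
Proof.
intros HM; unfold mesh_dz.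
apply Rdiv_lt_0_compat; [lra|apply lt_0_INR; lia].
Qed.

Lemma mesh_z_pos (M j : nat) : (1 <= M)%nat -> (1 <= j)%nat -> 0 < mesh_z M j.
Proof.
intros HM Hj; unfold mesh_z.
apply Rmult_lt_0_compat; [apply lt_0_INR; lia|apply mesh_dz_pos; exact HM].
Qed.

Lemma mesh_z_bounds (M j : nat) : (j < M)%nat -> 0 <= mesh_z M j < 1.
Proof.
intros Hj; unfold mesh_z.
assert (Hdz : 0 < mesh_dz M) by (apply mesh_dz_pos; lia).
assert (Hj0 : 0 <= INR j) by apply pos_INR.
assert (HjM : INR j < INR M) by (apply lt_INR; exact Hj).
assert (H1 : INR M * mesh_dz M = 1) by (unfold mesh_dz; field; lra).
split; nra.
Qed.

Lemma mesh_z_last (M : nat) : (1 <= M)%nat -> mesh_z M M = 1.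
Proof.
intros HM; unfold mesh_z, mesh_dz; field.
apply not_0_INR; lia.
Qed.

(** The front equation at level [n] involves only the profile at level [n-1],
    so this holds before anything is known about the new profile. *)
Lemma front_increment_pos d mu h0 T f u0 M N What Rhat (n : nat) :
  0 < mu -> (2 <= M)%nat ->
  scheme_S3 d mu h0 T f u0 M N What Rhat ->
  (1 <= n <= N)%nat ->
  0 < What (n - 1)%nat (M - 1)%nat -> What (n - 1)%nat M = 0 ->
  0 < delta_t (mesh_dt T N) Rhat n.
Proof.
intros Hmu HM HS Hn Hlast Hend.
rewrite (S3_front _ _ _ _ _ _ _ _ _ _ HS n Hn); unfold delta_z.
replace (M - 1 + 1)%nat with M by lia; rewrite Hend.
assert (Hdz : 0 < mesh_dz M) by (apply mesh_dz_pos; lia).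
assert (Hq : 0 < What (n - 1)%nat (M - 1)%nat / mesh_dz M)
  by (apply Rdiv_lt_0_compat; assumption).
replace (-2 * mu * ((0 - What (n - 1)%nat (M - 1)%nat) / mesh_dz M))
  with (2 * mu * (What (n - 1)%nat (M - 1)%nat / mesh_dz M)) by (field; lra).
apply Rmult_lt_0_compat; lra.
Qed.

Lemma profile_step_pos d mu h0 T L f u0 M N What Rhat (n : nat) :
  0 < d -> 0 < L -> 0 < mesh_dt T N -> mesh_dt T N < 1 / L ->
  (forall u : R, 0 <= u -> - L * u <= f u) ->
  (2 <= M)%nat ->
  scheme_S3 d mu h0 T f u0 M N What Rhat ->
  (1 <= n <= N)%nat ->
  0 < Rhat n -> 0 <= delta_t (mesh_dt T N) Rhat n ->
  (forall j : nat, (j <= M - 1)%nat -> 0 < What (n - 1)%nat j) ->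
  forall j : nat, (j <= M - 1)%nat -> 0 < What n j.
Proof.
intros Hd HL Hdt Hstep Hf HM HS Hn HR HdR Hold.
assert (Hdz : 0 < mesh_dz M) by (apply mesh_dz_pos; lia).
set (dt := mesh_dt T N) in *; set (dz := mesh_dz M) in *.
set (adv := delta_t dt Rhat n) in *.
(* The second difference splits into a forward minus a backward quotient; the
   drift, being a forward quotient, joins the former in [b]. *)
apply discrete_min_principle with
  (a := fun j => Rhat n * mesh_z M j / dt)
  (b := fun j => d * mesh_z M j / dz ^ 2
                 + (d + mesh_z M j ^ 2 * adv / 2) / dz)
  (c := fun j => d * mesh_z M j / dz ^ 2).
- exact HM.
- assert (Hleft := S3_left _ _ _ _ _ _ _ _ _ _ HS n Hn).
  unfold delta_z in Hleft; fold dz in Hleft; simpl in Hleft.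
  assert (What n 1%nat - What n 0%nat = 0); [|lra].
  replace (What n 1%nat - What n 0%nat)
    with ((What n 1%nat - What n 0%nat) / dz * dz) by (field; lra).
  rewrite Hleft; ring.
- exact (S3_right _ _ _ _ _ _ _ _ _ _ HS n Hn).
- intros j Hj.
  assert (Hz : 0 < mesh_z M j) by (apply mesh_z_pos; lia).
  assert (Heq := S3_interior _ _ _ _ _ _ _ _ _ _ HS n j Hn Hj).
  fold dt dz adv in Heq.
  set (z := mesh_z M j) in *.
  assert (Hw : 0 < What (n - 1)%nat j) by (apply Hold; lia).
  assert (Hdz2 : 0 < dz ^ 2) by (apply pow_lt; exact Hdz).
  assert (Hdiff : 0 < d * z / dz ^ 2)
    by (apply Rdiv_lt_0_compat; [apply Rmult_lt_0_compat|]; assumption).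
  assert (Hdrift : 0 < (d + z ^ 2 * adv / 2) / dz)
    by (apply Rdiv_lt_0_compat; [|exact Hdz]; nra).
  assert (HRz : 0 < Rhat n * z) by (apply Rmult_lt_0_compat; assumption).
  repeat split.
  + apply Rlt_le, Rdiv_lt_0_compat; assumption.
  + lra.
  + lra.
  + assert (Hreact : 0 < What (n - 1)%nat j / dt + f (What (n - 1)%nat j))
      by (apply explicit_reaction_pos with L; try apply Hf; lra).
    apply Rmult_lt_0_compat with (1 := HRz) in Hreact.
    rewrite Rmult_plus_distr_l, <- Heq in Hreact.
    unfold delta_z2, delta_z, delta_t in Hreact.
    replace (j - 1 + 1)%nat with j in Hreact by lia.
    match goal with |- 0 < ?e =>
      match type of Hreact with 0 < ?e' =>
        replace e with e' by (field; lra) end end.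
    exact Hreact.
Qed.

Theorem theorem3p3
  (d mu h0 T L : R)
  (hd : 0 < d) (hmu : 0 < mu) (hh0 : 0 < h0) (hT : 0 < T) (hL : 0 < L)
  (f : R -> R)
  (hf_diff : forall u : R, ex_derive f u)
  (hf_lin : forall u : R, 0 <= u -> - L * u <= f u <= L * u)
  (hf_der : forall u : R, 0 <= u -> Rabs (Derive f u) <= L)
  (u0 : R -> R)
  (hu0_C2 : C2_on 0 h0 u0)
  (hu0_der0 : D_in u0 (fun _ => 0) (icc 0 h0) 0)
  (hu0_end : u0 h0 = 0)
  (hu0_pos : forall r : R, 0 <= r < h0 -> 0 < u0 r)
  (M N : nat) (hM : (2 <= M)%nat) (hN : (1 <= N)%nat)
  (What : nat -> nat -> R) (Rhat : nat -> R)
  (hS3 : scheme_S3 d mu h0 T f u0 M N What Rhat)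
  (hdt : mesh_dt T N < 1 / L) :
  (forall n j : nat, (1 <= n <= N)%nat -> (0 <= j <= M - 1)%nat ->
     0 < What n j) /\
  (forall n : nat, (1 <= n <= N)%nat -> Rhat (n - 1)%nat < Rhat n).
Proof.
assert (Hdt : 0 < mesh_dt T N)
  by (apply Rdiv_lt_0_compat; [exact hT|apply lt_0_INR; lia]).
assert (Hadvance : forall n : nat, 0 < delta_t (mesh_dt T N) Rhat n ->
          Rhat (n - 1)%nat < Rhat n).
{ intros n Hn.
  assert (Hprod := Rmult_lt_0_compat _ _ Hn Hdt).
  unfold delta_t in Hprod.
  replace ((Rhat n - Rhat (n - 1)%nat) / mesh_dt T N * mesh_dt T N)
    with (Rhat n - Rhat (n - 1)%nat) in Hprod by (field; lra).
  lra. }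
assert (Hinv : forall n : nat, (n <= N)%nat ->
          0 < Rhat n /\ What n M = 0 /\
          forall j : nat, (j <= M - 1)%nat -> 0 < What n j).
{ induction n as [|n IHn]; intros Hn.
  - repeat split.
    + rewrite (S3_init_R _ _ _ _ _ _ _ _ _ _ hS3); apply pow_lt; exact hh0.
    + rewrite (S3_init_W _ _ _ _ _ _ _ _ _ _ hS3) by lia.
      rewrite mesh_z_last, Rmult_1_l by lia; exact hu0_end.
    + intros j Hj.
      rewrite (S3_init_W _ _ _ _ _ _ _ _ _ _ hS3) by lia.
      apply hu0_pos.
      assert (Hz := mesh_z_bounds M j ltac:(lia)); nra.
  - destruct IHn as [HR [Hend Hprof]]; [lia|].
    assert (Hpred : (S n - 1)%nat = n) by lia.
    assert (HdR : 0 < delta_t (mesh_dt T N) Rhat (S n)).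
    { apply (front_increment_pos _ _ _ _ _ _ _ _ _ _ (S n) hmu hM hS3);
        [lia| |]; rewrite Hpred; [apply Hprof; lia|exact Hend]. }
    assert (Hlt := Hadvance _ HdR); rewrite Hpred in Hlt.
    repeat split; [lra|apply (S3_right _ _ _ _ _ _ _ _ _ _ hS3); lia|].
    apply (profile_step_pos d mu h0 T L f u0 M N What Rhat (S n));
      try assumption; try lia; try lra.
    + intros u Hu; apply hf_lin; exact Hu.
    + rewrite Hpred; exact Hprof. }
split.
- intros n j Hn Hj; apply Hinv; lia.
- intros n Hn; apply Hadvance.
  destruct (Hinv (n - 1)%nat) as [_ [Hend Hprof]]; [lia|].
  apply (front_increment_pos _ _ _ _ _ _ _ _ _ _ n hmu hM hS3 Hn);
    [apply Hprof; lia|exact Hend].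
Qed.
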